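(* For every positive integer $n$, the vertices of $\mathrm{BTP}(n)$ are exactly the TSSCPP boolean triangles of order $n$.
   Context: A TSSCPP boolean triangle of order $n$ is a triangular array $(b_{i,n-j})_{1\le j\le i\le n-1}$ (so $\binom{n}{2}$ entries) with entries in $\{0,1\}$ such that for all $1\le j<i\le n-1$, $$1+\sum_{k=j+1}^{i}b_{k,n-j-1}\ge\sum_{k=j}^{i}b_{k,n-j}.$$ $\mathrm{BTP}(n)$ is the convex hull in $\mathbb{R}^{\binom{n}{2}}$ (coordinates indexed by the positions $(i,n-j)$, $1\le j\le i\le n-1$) of all TSSCPP boolean triangles of order $n$. *)

(* Defs.v *)
From HB Require Import structures.
From mathcomp Require Import all_boot all_order all_algebra.
From mathcomp Require Import boolp classical_sets reals convex.

Set Implicit Arguments.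
Unset Strict Implicit.
Unset Printing Implicit Defensive.

Import Order.TTheory GRing.Theory Num.Theory.
Local Open Scope classical_set_scope.
Local Open Scope ring_scope.

Definition convex_hull (R : numDomainType) (V : lmodType R) (A : set V) :
  set V := smallest (@convex_set R V) A.

(* F is cut out of P by a linear inequality f x <= c valid on P. *)
Definition face (R : numDomainType) (V : lmodType R) (P F : set V) : Prop :=
  exists (f : {linear V -> R^o}) (c : R),
    (forall x, P x -> f x <= c) /\ F = [set x | P x /\ f x = c].

(* The vertices of a polytope are its faces of dimension 0. *)
Definition vertices (R : numDomainType) (V : lmodType R) (P : set V) : set V :=
  [set v | face P [set v]].

(* The pair (i, j) with 1 <= j <= i <= n-1 stands for the position (i, n-j):
   columns are numbered by j instead of n-j, so that column n-j-1 is
   numbered j+1. *)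
Definition position (n : nat) : finType :=
  {p : 'I_n * 'I_n | (1 <= p.2 <= p.1)%N}.

Notation triangle R n := {ffun position n -> R^o}.

(* The sum of b_(k, n-j) over l <= k <= i. All such (k, n-j) are positions as
   soon as 1 <= j <= l and i < n. *)
Definition colsum (R : realType) (n : nat) (b : triangle R n) (j l i : nat) : R :=
  \sum_(p : position n | ((val p).2 == j :> nat) && (l <= (val p).1 <= i)%N) b p.

Definition tsscpp_boolean_triangle (R : realType) (n : nat) :
  set (triangle R n) :=
  [set b : triangle R n | (forall p : position n, b p = 0 \/ b p = 1) /\
           (forall i j : nat, (1 <= j)%N -> (j < i)%N -> (i <= n - 1)%N ->
              colsum b j j i <= 1 + colsum b j.+1 j.+1 i)].

Definition BTP (R : realType) (n : nat) : set (triangle R n) :=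
  convex_hull (@tsscpp_boolean_triangle R n).

(* Main.v *)
(* If v is the unique maximizer of a linear functional over a set A, it is also
   its unique maximizer over the convex hull of A; conversely, a unique
   maximizer over the hull must belong to A, since otherwise the functional
   would be strictly smaller on A, hence on the hull.  So a set and its convex
   hull have the same vertices.  Every 0/1 vector b in a set of 0/1 vectors is
   a vertex of it, as x |-> \sum_p (2 b_p - 1) x_p is maximized on the 0/1 cube
   only at b. *)
Require Import Defs.
From mathcomp Require Import all_boot all_order all_algebra reals.
From HB Require Import structures.
From mathcomp Require Import boolp classical_sets interval_inference convex.

Set Implicit Arguments.
Unset Strict Implicit.
Unset Printing Implicit Defensive.

Import Order.TTheory GRing.Theory Num.Theory.
Local Open Scope classical_set_scope.
Local Open Scope ring_scope.

Section ConvexHull.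
Context (R : numDomainType) (V : lmodType R).
Implicit Types (A : set V) (f : {linear V -> R^o}) (c : R).

(** [P] cuts out a convex set containing [A]; convexity need only be tested at weights strictly
    between 0 and 1. *)
Lemma convex_hull_ind A (P : V -> Prop) :
  (forall x, A x -> P x) ->
  (forall x y (t : R), 0 < t -> t < 1 -> P x -> P y ->
     P (t *: x + (1 - t) *: y)) ->
  forall x, convex_hull A x -> P x.
Proof.
move=> AP Pconv; apply: smallest_sub; last exact: AP.
apply/convex_setW => x y /set_mem Px /set_mem Py t t0 t1.
by apply/mem_set; apply: Pconv.
Qed.

Lemma sub_convex_hull A : A `<=` convex_hull A.
Proof. exact: sub_gen_smallest. Qed.

Lemma conv_lt (t u v c : R) :
  0 < t -> t < 1 -> u < c -> v <= c -> t * u + (1 - t) * v < c.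
Proof.
move=> t0 t1 uc vc; rewrite -[ltRHS]mul1r -[X in X * c](subrKC t) [ltRHS]mulrDl.
by rewrite ltr_leD ?ltr_pM2l// ler_pM2l// subr_gt0.
Qed.

Lemma conv_le (t u v c : R) :
  0 < t -> t < 1 -> u <= c -> v <= c -> t * u + (1 - t) * v <= c.
Proof.
move=> t0 t1 uc vc; rewrite -[leRHS]mul1r -[X in X * c](subrKC t) [leRHS]mulrDl.
by rewrite lerD ?ler_pM2l// subr_gt0.
Qed.

Lemma conv_eq (t u v c : R) :
  0 < t -> t < 1 -> u <= c -> v <= c -> t * u + (1 - t) * v = c ->
  u = c /\ v = c.
Proof.
move=> t0 t1 uc vc e; split; apply/eqP.
- apply: contra_eqT e => uNc; rewrite lt_eqF// conv_lt//.
  by rewrite lt_neqAle uNc.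
(* The weights [t] and [1 - t] are exchanged, so that the strict bound falls on the first point, as
   [conv_lt] requires. *)
- apply: contra_eqT e => vNc; rewrite addrC -{2}(subKr 1 t).
  by rewrite lt_eqF// conv_lt ?subr_gt0 ?gtrBl// lt_neqAle vNc.
Qed.

Lemma convex_hull_lt A f c :
  (forall x, A x -> f x < c) -> forall x, convex_hull A x -> f x < c.
Proof.
move=> Ac; apply: convex_hull_ind Ac _ => x y t t0 t1 xc yc.
by rewrite linearD !linearZ conv_lt// ltW.
Qed.

(** The bound [c] in [face] is forced to be [f v], since [v] lies on the face. *)
Lemma verticesP A v :
  vertices A v <-> A v /\ exists f : {linear V -> R^o},
    forall x, A x -> f x <= f v /\ (f x = f v -> x = v).
Proof.
split=> [[f [c [fc E]]]|[Av [f fv]]].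
- have [Av fvc] : [set x | A x /\ f x = c] v by rewrite -E.
  split=> //; exists f => x Ax; rewrite fvc; split; first exact: fc.
  by move=> fxc; have : [set v] x by rewrite E.
- exists f, (f v); split=> [x /fv[]//|].
  by apply/seteqP; split=> [x ->//|x [Ax]]; apply: (fv x Ax).2.
Qed.

Lemma vertices_convex_hull A : vertices (convex_hull A) = vertices A.
Proof.
apply/seteqP; split=> v /verticesP[Av [f fv]]; apply/verticesP; last first.
  split; first exact: sub_convex_hull.
  (* The induction carries the equality clause along: by [conv_eq], a combination reaching [f v] has
     both endpoints at [f v], hence both equal to [v]. *)
  exists f; apply: convex_hull_ind fv _ => x y t t0 t1 [xle xeq] [yle yeq].
  rewrite linearD !linearZ; split; first exact: conv_le.
  move=> /conv_eq[]// /xeq-> /yeq->.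
  by rewrite -scalerDl subrKC scale1r.
split; last by exists f => x /sub_convex_hull /fv.
(* Strictness on [A] passes to the hull, which contains [v]. *)
apply: contrapT => NAv; suff : f v < f v by rewrite ltxx.
apply: convex_hull_lt Av => x Ax.
have [xle xeq] := fv x (sub_convex_hull Ax).
rewrite lt_neqAle xle andbT; apply/eqP => /xeq xv.
by apply: NAv; rewrite -xv.
Qed.

End ConvexHull.

Section WeightedSum.
Context (R : comNzRingType) (I : finType) (w : I -> R).

Definition weighted_sum (x : {ffun I -> R^o}) : R^o := \sum_i w i * x i.

Lemma weighted_sum_is_linear : linear weighted_sum.
Proof.
move=> a x y; rewrite /weighted_sum scaler_sumr -big_split/=.
by apply: eq_bigr => i _; rewrite !ffunE mulrDr /GRing.scale/= mulrCA.
Qed.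

HB.instance Definition _ :=
  GRing.isLinear.Build R {ffun I -> R^o} R^o _ weighted_sum
    weighted_sum_is_linear.

End WeightedSum.

Lemma vertices_01 (R : numDomainType) (I : finType) (A : set {ffun I -> R^o}) :
  (forall x, A x -> forall i, x i = 0 \/ x i = 1) -> vertices A = A.
Proof.
move=> A01; apply/seteqP; split=> [v /verticesP[]//|b Ab].
apply/verticesP; split=> //; exists (weighted_sum (fun i => 2 * b i - 1)).
move=> x Ax.
(* The weight is [1] where [b i = 1] and [-1] where [b i = 0], so each term is largest exactly at
   [x i = b i]; the equality case is kept for the sum. *)
have le_term i : (2 * b i - 1) * x i <= (2 * b i - 1) * b i ?= iff (x i == b i).
  have r01 := @ltr01 R; have r10 := @oner_neq0 R.
  case: (A01 b Ab i) => ->; case: (A01 x Ax i) => ->;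
    rewrite ?mulr0 ?mulr1 ?sub0r ?[2 - 1]addrK; split;
    by rewrite ?eqxx ?lerN10 ?ler01 ?oppr_eq0 ?(eq_sym 0) ?(negPf r10).
have [le_sum eq_sum] := leif_sum (fun i (_ : true) => le_term i).
split=> // /eqP sum_eq; have /forallP xb : [forall i, x i == b i].
  by rewrite -eq_sum.
by apply/ffunP => i; apply/eqP/xb.
Qed.

Theorem theorem5p5 (R : realType) (n : nat) (n_gt0 : (0 < n)%N) :
  vertices (@BTP R n) = @tsscpp_boolean_triangle R n.
Proof.
by rewrite /BTP vertices_convex_hull; apply: vertices_01 => x [].
Qed.
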